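(* Let $T$ be an almost symmetric numerical semigroup with odd type $t$. If a numerical semigroup $S$ is one half of $T$, i.e. $S=\frac{T}{2}$, then $t(S)\geq \frac{t-1}{2}$, where $t(S)$ denotes the type of $S$.
   Context: $\mathbb{N}$ denotes the non-negative integers. A numerical semigroup $S$ is a submonoid of $\mathbb{N}$ with $\mathbb{N}\setminus S$ finite. Its Frobenius number is $f(S)=\max(\mathbb{Z}\setminus S)$ (so $f(\mathbb{N})=-1$). The set of pseudo-Frobenius numbers is $\mathrm{PF}(S)=\{x\in\mathbb{Z}\setminus S \mid x+s\in S \text{ for any } s\in S\setminus\{0\}\}$; its cardinality is the type $t(S)$. Set $\mathrm{L}(S)=\{x\in\mathbb{Z} \mid x\notin S \text{ and } f(S)-x\notin S\}$. $S$ is almost symmetric if $\mathrm{L}(S)\subseteq \mathrm{PF}(S)$. For a numerical semigroup $T$, $\frac{T}{2}=\{s\in\mathbb{N}\mid 2s\in T\}$; $S$ is one half of $T$ if $S=\frac{T}{2}$. *)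

(* Defs.v *)
From HB Require Import structures.
From mathcomp Require Import all_boot all_order all_algebra finmap.
From mathcomp Require Import all_classical.

Set Implicit Arguments.
Unset Strict Implicit.
Unset Printing Implicit Defensive.

Import Order.TTheory GRing.Theory Num.Theory.

Local Open Scope classical_set_scope.
Local Open Scope ring_scope.

Definition numerical_semigroup (S : set nat) : Prop :=
  [/\ S 0%N, (forall a b : nat, S a -> S b -> S (a + b)%N)
    & finite_set (~` S)].

(* S viewed as a subset of the integers; complements below are taken in int *)
Definition zset (S : set nat) : set int := Posz @` S.

(* The value -1 passed to xget is a default, never used when S is a numerical
   semigroup: see frobeniusP. *)
Definition frobenius (S : set nat) : int :=
  xget (-1) [set f : int | (~` zset S) f /\ ubound (~` zset S) f].

Definition PF (S : set nat) : set int :=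
  [set x : int | ~ zset S x /\
     forall s : nat, S s -> s <> 0%N -> zset S (x + s%:Z)].

(* fset_set is the empty fset on an infinite set; PF S is finite when S is a
   numerical semigroup: see finite_PF. *)
Definition semigroup_type (S : set nat) : nat := #|` fset_set (PF S)|.

Definition L (S : set nat) : set int :=
  [set x : int | ~ zset S x /\ ~ zset S (frobenius S - x)].

Definition almost_symmetric (S : set nat) : Prop := L S `<=` PF S.

Definition one_half (T : set nat) : set nat := [set s : nat | T (2 * s)%N].

Lemma zsetP (S : set nat) (n : nat) : zset S n%:Z <-> S n.
Proof. by split=> [[m Sm [<-]]//|Sn]; exists n. Qed.

Lemma numerical_semigroup_conductor (S : set nat) :
  numerical_semigroup S -> exists N : nat, forall n : nat, (N <= n)%N -> S n.
Proof.
case=> _ _ /finite_fsetP[A hA].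
exists (\max_(i <- A) i).+1 => n hn; apply: contrapT => nSn.
have nA : n \in A by have : (~` S) n by []; rewrite hA.
by have := @leq_bigmax_seq _ (enum_fset A) xpredT id n nA isT; rewrite leqNgt hn.
Qed.

Lemma frobeniusP (S : set nat) : numerical_semigroup S ->
  ~ zset S (frobenius S) /\ forall x : int, ~ zset S x -> x <= frobenius S.
Proof.
move=> hS.
suff [f hf] : exists f : int, (~` zset S) f /\ ubound (~` zset S) f.
  by rewrite /frobenius; case: xgetP => [y _ [? h]|/(_ f)//]; split.
have [N hN] := numerical_semigroup_conductor hS.
have [N0 hN0 minN] : exists2 N0, (forall n : nat, (N0 <= n)%N -> S n)
    & forall k, (forall n : nat, (k <= n)%N -> S n) -> (N0 <= k)%N.
  have ex : exists n, `[< forall m : nat, (n <= m)%N -> S m >].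
    by exists N; apply/asboolP.
  exists (ex_minn ex); case: ex_minnP => m /asboolP hm minm //.
  by move=> k hk; apply: minm; apply/asboolP.
exists (N0%:Z - 1); split.
  case: N0 hN0 minN => [|M] hM minM; first by case.
  rewrite -[M.+1]addn1 PoszD addrK => /zsetP SM.
  have /minM : forall n : nat, (M <= n)%N -> S n.
    by move=> n; rewrite leq_eqVlt => /orP[/eqP<-//|]; apply: hM.
  by rewrite ltnn.
move=> x nx; rewrite leNgt; apply/negP => lt; apply: nx.
have le : N0%:Z <= x by rewrite -[N0%:Z](subrK 1) lezD1.
case: x lt le => // n _; rewrite lez_nat => le.
by apply/zsetP/hN0.
Qed.

Lemma finite_PF (S : set nat) : numerical_semigroup S -> finite_set (PF S).
Proof.
move=> hS; have [N hN] := numerical_semigroup_conductor hS.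
apply: (@sub_finite_set _ _
  ((fun i : nat => i%:Z - N.+1%:Z) @` `I_(N.+1 + N)%N)); last first.
  exact/finite_image/finite_II.
move=> x [nx hx]; have SN : S N.+1 by apply/hN/leqnSn.
have [n _ xE] : zset S (x + N.+1%:Z) by apply: hx.
exists n; last by rewrite xE addrK.
rewrite /= ltnNge; apply/negP => le; apply: nx.
have -> : x = (n - N.+1)%N%:Z.
  by rewrite -subzn ?xE ?addrK // (leq_trans _ le) // leq_addr.
by apply/zsetP/hN; rewrite leq_subRL // (leq_trans _ le) // leq_addr.
Qed.

(* Main.v *)
(* Write f for the Frobenius number of T.  Almost symmetry makes PF(T) \ {f}
   stable under the reflection x |-> f - x.  If f were even, f / 2 would be the
   only fixed point of this reflection, so the type of T would be even.  Hence
   f is odd, the reflection exchanges parities, and at least (t - 1) / 2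
   elements of PF(T) are even; halving them embeds them into PF(S). *)
Require Import Defs.
From mathcomp Require Import all_boot all_order all_algebra finmap.
From mathcomp Require Import all_classical.
From mathcomp Require Import zify lra.

Import Order.TTheory GRing.Theory Num.Theory.

Local Open Scope classical_set_scope.
Local Open Scope ring_scope.

Lemma leq_card_fset_inj (K K' : choiceType) (g : K -> K')
    (A : {fset K}) (B : {fset K'}) :
  {in A &, injective g} -> {in A, forall x, g x \in B} ->
  (#|` A| <= #|` B|)%N.
Proof.
move=> injg gB; rewrite -(card_in_imfset imfset_key injg).
by apply/fsubset_leq_card/fsubsetP => _ /imfsetP[x xA ->]; apply: gB.
Qed.

Lemma card_fset_filterC (K : choiceType) (A : {fset K}) (p : pred K) :
  (#|` [fset x in A | p x]%fset| + #|` [fset x in A | ~~ p x]%fset|)%N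
  = #|` A|.
Proof.
rewrite -(cardfsID [fset x in A | p x]%fset A); congr (_ + _)%N;
  congr (#|` _|); apply/fsetP => x; rewrite !inE /=;
  by case: (x \in A); case: (p x).
Qed.

(** Once the fixed point [h] is removed, the reflection about [h] exchanges the elements below [h]
    with those above it, so the two sides are equinumerous. *)
Lemma odd_card_reflection (A : {fset int}) (h : int) :
  h \in A -> {in A, forall x, h *+ 2 - x \in A} -> odd #|` A|.
Proof.
move=> hA refl.
rewrite (cardfsD1 h) hA -(card_fset_filterC _ _ (fun x => x < h)).
set B := [fset x in _ | _ < _]%fset; set C := [fset x in _ | _]%fset.
suff -> : #|` C| = #|` B| by rewrite addnn /= odd_double.
apply/eqP; rewrite eqn_leq; apply/andP; split;
  apply: (@leq_card_fset_inj _ _ (fun x => h *+ 2 - x));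
  try (by move=> x y _ _; lia);
  by move=> x; rewrite !inE /= => /andP[/andP[neq /refl ->]]; lia.
Qed.

Section PseudoFrobenius.
Variable S : set nat.
Hypothesis hS : numerical_semigroup S.

Lemma frobenius_notin : ~ zset S (frobenius S).
Proof. by have [] := frobeniusP hS. Qed.

Lemma frobenius_PF : PF S (frobenius S).
Proof.
split=> [|s _ s0]; first exact: frobenius_notin.
by apply: contrapT => /(frobeniusP hS).2; lia.
Qed.

(** If [s = frobenius S - x] were in [S], it would be nonzero, and the pseudo-Frobenius property of
    [x] would put [x + s = frobenius S] in [S]. Under almost symmetry the reflected point is again
    in [PF S]. *)
Lemma PF_reflection_L (x : int) :
  PF S x -> x <> frobenius S -> L S (frobenius S - x).
Proof.
move=> [nx hx] xf; split; last by rewrite opprB addrC subrK.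
move=> [s Ss sE]; apply: frobenius_notin.
by rewrite -[frobenius S](subrK x) -sE addrC; apply: hx => // s0; lia.
Qed.

Lemma half_frobenius_L (h : int) : frobenius S = h *+ 2 -> L S h.
Proof.
move=> fE; have nh : ~ zset S h.
  move=> [n Sn nE]; apply: frobenius_notin; exists (n + n)%N; last by lia.
  by case: hS => _ + _; apply.
by split=> //; rewrite fE mulr2n addrK.
Qed.

Lemma mem_PF (x : int) : (x \in fset_set (PF S)) = (x \in PF S).
Proof. exact/in_fset_set/finite_PF. Qed.

Hypothesis asS : almost_symmetric S.

Lemma almost_symmetric_odd_frobenius :
  odd (semigroup_type S) -> ~~ (2 %| frobenius S)%Z.
Proof.
move=> oddt; apply/negP => /dvdzP[h fE].
have {}fE : frobenius S = h *+ 2 by rewrite fE; lia.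
have S0 : S 0%N by case: hS.
(* This gives [h <> frobenius S], so [h] survives the removal of the Frobenius number from
   [PF S]. *)
have f0 : frobenius S != 0.
  by apply/eqP => f0; apply: frobenius_notin; rewrite f0; apply/zsetP.
move: oddt; rewrite /semigroup_type (cardfsD1 (frobenius S)) mem_PF.
rewrite (mem_set frobenius_PF) /= => /negP; apply.
apply: (@odd_card_reflection _ h) => [|x].
  rewrite in_fsetD1 mem_PF mem_set ?andbT; first by lia.
  exact/asS/half_frobenius_L.
rewrite !in_fsetD1 !mem_PF => /andP[/eqP xf /set_mem PFx].
rewrite -fE mem_set ?andbT; last exact/asS/PF_reflection_L.
(* The reflection could only hit the removed point from [x = 0], which lies in [S]. *)
apply/eqP => x0; have {}x0 : x = 0 by lia.
by case: PFx => + _; apply; rewrite x0; apply/zsetP.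
Qed.

(** The reflection sends the odd elements other than [frobenius S] injectively to even ones; the
    successor accounts for [frobenius S] itself. *)
Lemma almost_symmetric_even_PF : odd (semigroup_type S) ->
  (semigroup_type S <= #|` [fset x in fset_set (PF S) | (2 %| x)%Z]%fset|.*2.+1)%N.
Proof.
move=> /almost_symmetric_odd_frobenius oddf.
rewrite /semigroup_type -(card_fset_filterC _ _ (fun x => (2 %| x)%Z)).
set E := [fset x in _ | _]%fset; set O := [fset x in _ | ~~ _]%fset.
suff : (#|` (O `\ frobenius S)%fset| <= #|` E|)%N.
  rewrite (cardfsD1 (frobenius S) O); case: (_ \in O); lia.
apply: (@leq_card_fset_inj _ _ (fun x => frobenius S - x)).
  by move=> x y _ _; lia.
move=> x; rewrite !inE /= !mem_PF => /and3P[/eqP xf /set_mem PFx oddx].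
rewrite mem_set /=; last exact/asS/PF_reflection_L.
lia.
Qed.

End PseudoFrobenius.

Lemma PF_one_half (T : set nat) (y : int) : PF T (y * 2) -> PF (one_half T) y.
Proof.
have halfP z : zset (one_half T) z <-> zset T (z * 2).
  split=> [[n Tn <-]|[n Tn nE]]; first by exists (2 * n)%N => //; lia.
  (* A negative [z] is excluded, as its double cannot equal the natural number [n]. *)
  case: z nE => [m|m] nE; last by lia.
  by apply/zsetP; rewrite /one_half /= (_ : (2 * m)%N = n) //; lia.
move=> [ny hy]; split=> [/halfP//|s Ts s0]; apply/halfP.
rewrite (_ : _ * 2 = y * 2 + (2 * s)%N%:Z); last by lia.
by apply: hy => //; lia.
Qed.

Theorem theorem3p1 (T S : set nat)
  (hT : numerical_semigroup T) (hTas : almost_symmetric T)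
  (hodd : odd (semigroup_type T))
  (hS : numerical_semigroup S) (hST : S = one_half T) :
  ((semigroup_type T)%:R - 1) / 2 <= (semigroup_type S)%:R :> rat.
Proof.
suff: (semigroup_type T <= (semigroup_type S).*2.+1)%N.
  by rewrite -(ler_nat rat) -addn1 -muln2 natrD natrM; lra.
apply: leq_trans (almost_symmetric_even_PF _ hT hTas hodd) _.
rewrite ltnS leq_double.
(* The quotient by 2 is injective here because only even elements are involved. *)
apply: (@leq_card_fset_inj _ _ (fun x => (x %/ 2)%Z)).
  by move=> x y; rewrite !inE /= => /andP[_ ?] /andP[_ ?]; lia.
move=> x; rewrite !inE /= (mem_PF _ hT) (mem_PF _ hS) => /andP[/set_mem PFx x2].
by apply/mem_set; rewrite hST; apply: PF_one_half; rewrite divzK.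
Qed.
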